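(* Let $\widetilde{M}$ be an $(LCS)_n$-manifold with structure $(\phi,\xi,\eta,g,\alpha)$ and quarter symmetric metric connection $\overline{\widetilde{\nabla}}$, let $M$ be an invariant submanifold of $\widetilde{M}$ of dimension $m<n$ with induced metric $g$, and let $\overline{\nabla}$ be the connection induced on $M$ from $\overline{\widetilde{\nabla}}$. If $(g,\xi,\lambda)$ is a Ricci soliton on $M$ with respect to the quarter symmetric metric connection, then $M$ is $\eta$-Einstein with respect to the Levi-Civita connection.
   Context: An $(LCS)_n$-manifold (Lorentzian concircular structure manifold) is an $n$-dimensional Lorentzian manifold $(\widetilde{M},g)$ (smooth, connected, paracompact, Hausdorff; signature $(-,+,\dots,+)$) with Levi-Civita connection $\widetilde{\nabla}$, together with a unit timelike vector field $\xi$ ($g(\xi,\xi)=-1$), the 1-form $\eta(X)=g(X,\xi)$, a nowhere-zero smooth function $\alpha$ such that $\widetilde{\nabla}_X\xi=\alpha\{X+\eta(X)\xi\}$ for all $X$ (equivalently $(\widetilde{\nabla}_X\eta)(Y)=\alpha\{g(X,Y)+\eta(X)\eta(Y)\}$) and $d\alpha=\rho\,\eta$ with $\rho=-(\xi\alpha)$, and the $(1,1)$-tensor $\phi X=\frac1\alpha\widetilde{\nabla}_X\xi=X+\eta(X)\xi$. The quarter symmetric metric connection on $\widetilde{M}$ is $\overline{\widetilde{\nabla}}_XY=\widetilde{\nabla}_XY+\eta(Y)\phi X-g(\phi X,Y)\xi$ (it is the metric connection with torsion $T(X,Y)=\eta(Y)\phi X-\eta(X)\phi Y$). A submanifold $M$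 of $\widetilde{M}$ is invariant if $\xi$ is tangent to $M$ at every point of $M$ and $\phi X$ is tangent to $M$ for every $X$ tangent to $M$, i.e. $\phi(TM)\subset TM$. The induced metric on $M$ is also denoted $g$, and the restrictions of $\xi,\eta$ to $M$ are denoted by the same symbols. The induced connection $\overline{\nabla}$ on $M$ is the tangential part of $\overline{\widetilde{\nabla}}$: $\overline{\widetilde{\nabla}}_XY=\overline{\nabla}_XY+\overline{h}(X,Y)$ for $X,Y$ tangent to $M$, with $\overline{\nabla}_XY$ tangent and $\overline{h}(X,Y)$ normal to $M$. $(g,\xi,\lambda)$, with $\lambda\in\mathbb{R}$, is a Ricci soliton on $M$ with respect to the quarter symmetric metric connection if $(\overline{\pounds}_\xi g)(Y,Z)+2\overline{S}(Y,Z)+2\lambda g(Y,Z)=0$ for all $Y,Z$ tangent to $M$, where $(\overline{\pounds}_\xi g)(Y,Z)=g(\overline{\nabla}_Y\xi,Z)+g(Y,\overline{\nabla}_Z\xi)$ and $\overline{S}$ is the Ricci tensor of $\overline{\nabla}$, i.e. $\overline{S}(Y,Z)=\mathrm{trace}\{X\mapsto\overline{R}(X,Y)Z\}$ with $\overline{R}(X,Y)Z=\overline{\nabla}_X\overline{\nabla}_YZ-\overline{\nabla}_Y\overline{\nabla}_XZ-\overline{\nabla}_{[X,Y]}Z$. $M$ is $\eta$-Einstein with respect to the Levi-Civita connection if the Ricci tensor $S$ of the Levi-Civita connection of $(M,g)$ satisfies $S=p\,g+q\,\eta\otimes\eta$ for some smooth functions $p,q$ on $M$. *)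

(* Defs.v *)
From HB Require Import structures.
From mathcomp Require Import all_boot all_order all_algebra.
From mathcomp Require Import all_classical all_reals all_analysis.
Set Implicit Arguments.
Unset Strict Implicit.
Unset Printing Implicit Defensive.
Import Order.TTheory GRing.Theory Num.Theory.
Import numFieldNormedType.Exports.
Local Open Scope classical_set_scope.
Local Open Scope ring_scope.

(* Geometric objects on a manifold are represented by their expressions in    *)
(* the charts of a fixed smooth atlas, subject to the usual transformation    *)
(* laws.  In a chart of an n-dimensional manifold, tangent vectors are row    *)
(* vectors in 'rV_n, and 'D_u F x is the image of u under the tangent map of  *)
(* F at x.  Chart expressions are total functions, and only their values on   *)
(* the (open) image of the chart are meaningful.                              *)

(* For V finite-dimensional and U open, the usual classes C^k(U) and          *)
(* C^infty(U).                                                                *)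
Fixpoint Ck (R : realType) (V W : normedModType R) (k : nat) (U : set V)
    (f : V -> W) : Prop :=
  match k with
  | 0%N => forall x, U x -> {for x, continuous f}
  | k'.+1 => (forall x, U x -> differentiable f x) /\
             (forall v, Ck k' U (fun x => 'D_v f x))
  end.

Definition smooth_on (R : realType) (V W : normedModType R) (U : set V)
    (f : V -> W) : Prop := forall k, Ck k U f.

Definition paracompact (T : topologicalType) : Prop :=
  forall C : set (set T),
    (forall U, C U -> open U) -> \bigcup_(U in C) U = setT ->
  exists D : set (set T),
    [/\ forall V, D V -> open V /\ (exists2 U, C U & V `<=` U),
        \bigcup_(V in D) V = setT &
        forall p : T, exists2 N, nbhs p N &
          finite_set [set V | D V /\ V `&` N !=set0]].

Section Manifolds.
Variable R : realType.

Record chart (T : topologicalType) (n : nat) := Chart {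
  cdom : set T;
  cimg : set 'rV[R]_n;
  cmap : T -> 'rV[R]_n;
  cinv : 'rV[R]_n -> T;
  cdom_open : open cdom;
  cimg_open : open cimg;
  cmap_img : forall p, cdom p -> cimg (cmap p);
  cinv_dom : forall x, cimg x -> cdom (cinv x);
  cmapK : forall p, cdom p -> cinv (cmap p) = p;
  cinvK : forall x, cimg x -> cmap (cinv x) = x;
  cmap_continuous : forall p, cdom p -> {for p, continuous cmap};
  cinv_continuous : forall x, cimg x -> {for x, continuous cinv} }.

(* Coordinate expression of f : S -> T, and its domain; for f = id this is    *)
(* the transition map from c to d.                                            *)
Definition loc (S T : topologicalType) (m n : nat) (f : S -> T)
    (c : chart S m) (d : chart T n) : 'rV[R]_m -> 'rV[R]_n :=
  fun x => cmap d (f (cinv c x)).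

Definition locdom (S T : topologicalType) (m n : nat) (f : S -> T)
    (c : chart S m) (d : chart T n) : set 'rV[R]_m :=
  [set x | cimg c x /\ cdom d (f (cinv c x))].

Record manifold (n : nat) := Manifold {
  carrier :> topologicalType;
  atlas : Type;
  coord : atlas -> chart carrier n;
  atlas_cover : forall p : carrier, exists c, cdom (coord c) p;
  atlas_compat : forall c d : atlas,
    smooth_on (locdom id (coord c) (coord d)) (loc id (coord c) (coord d));
  manifold_hausdorff : hausdorff_space carrier;
  manifold_paracompact : paracompact carrier }.

Definition img (n : nat) (M : manifold n) (c : atlas M) : set 'rV[R]_n :=
  cimg (coord c).

Definition smooth_fun (n : nat) (M : manifold n) (f : M -> R) : Prop :=
  forall c : atlas M,
    smooth_on (img c) (fun x => f (cinv (coord c) x) : R^o).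

Definition local_field (n : nat) (M : manifold n) (c : atlas M)
    (X : 'rV[R]_n -> 'rV[R]_n) : Prop := smooth_on (img c) X.

(* Pushforward of a vector field, as a vector field along F. *)
Definition push (m n : nat) (F : 'rV[R]_m -> 'rV[R]_n)
    (X : 'rV[R]_m -> 'rV[R]_m) : 'rV[R]_m -> 'rV[R]_n :=
  fun x => 'D_(X x) F x.

Definition bracket (n : nat) (X Y : 'rV[R]_n -> 'rV[R]_n) :
    'rV[R]_n -> 'rV[R]_n :=
  fun x => 'D_(X x) Y x - 'D_(Y x) X x.

Record vfield (n : nat) (M : manifold n) := VField {
  vf :> atlas M -> 'rV[R]_n -> 'rV[R]_n;
  vf_smooth : forall c, local_field c (vf c);
  vf_tensor : forall (c d : atlas M) x, locdom id (coord c) (coord d) x ->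
    vf d (loc id (coord c) (coord d) x)
      = 'D_(vf c x) (loc id (coord c) (coord d)) x }.

(* Pseudo-Riemannian metrics. *)
Record metric (n : nat) (M : manifold n) := Metric {
  gf :> atlas M -> 'rV[R]_n -> 'rV[R]_n -> 'rV[R]_n -> R;
  gf_smooth : forall c u v, smooth_on (img c) (fun x => gf c x u v : R^o);
  gf_linear : forall c x, img c x -> forall a u1 u2 v,
    gf c x (a *: u1 + u2) v = a * gf c x u1 v + gf c x u2 v;
  gf_sym : forall c x, img c x -> forall u v, gf c x u v = gf c x v u;
  gf_nondeg : forall c x, img c x ->
    forall u, (forall v, gf c x u v = 0) -> u = 0;
  gf_tensor : forall (c d : atlas M) x, locdom id (coord c) (coord d) x ->
    let T := loc id (coord c) (coord d) in
    forall u v, gf d (T x) ('D_u T x) ('D_v T x) = gf c x u v }.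

(* Signature (-,+,...,+): the rows of b form an orthonormal basis. *)
Definition lorentzian (n : nat) (M : manifold n) (g : metric M) : Prop :=
  forall (c : atlas M) x, img c x ->
  exists2 b : 'M[R]_n, b \in unitmx &
    forall i j : 'I_n, g c x (row i b) (row j b) =
      if i != j then 0 else if (i : nat) == 0%N then -1 else 1.

(* Covariant derivative, along X, of a vector field V along F, for the        *)
(* connection with Christoffel symbols G: (D_X V)^k =                         *)
(* X^i d_i V^k + G^k_{ij}(F) (F_* X)^i V^j.                                   *)
Definition along (m n : nat)
    (G : 'rV[R]_n -> 'rV[R]_n -> 'rV[R]_n -> 'rV[R]_n)
    (F : 'rV[R]_m -> 'rV[R]_n) (X : 'rV[R]_m -> 'rV[R]_m)
    (V : 'rV[R]_m -> 'rV[R]_n) : 'rV[R]_m -> 'rV[R]_n :=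
  fun x => 'D_(X x) V x + G (F x) ('D_(X x) F x) (V x).

Definition cov (n : nat) (G : 'rV[R]_n -> 'rV[R]_n -> 'rV[R]_n -> 'rV[R]_n)
    (X Y : 'rV[R]_n -> 'rV[R]_n) : 'rV[R]_n -> 'rV[R]_n :=
  fun x => 'D_(X x) Y x + G x (X x) (Y x).

(* Affine connections; chr c x u v = G^k_{ij} u^i v^j is the covariant        *)
(* derivative of the constant field v in the direction u.                     *)
Record connection (n : nat) (M : manifold n) := Connection {
  chr :> atlas M -> 'rV[R]_n -> 'rV[R]_n -> 'rV[R]_n -> 'rV[R]_n;
  chr_smooth : forall c u v, smooth_on (img c) (fun x => chr c x u v);
  chr_linear_l : forall c x, img c x -> forall a u1 u2 v,
    chr c x (a *: u1 + u2) v = a *: chr c x u1 v + chr c x u2 v;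
  chr_linear_r : forall c x, img c x -> forall a u v1 v2,
    chr c x u (a *: v1 + v2) = a *: chr c x u v1 + chr c x u v2;
  chr_transform : forall (c d : atlas M) X Y,
    local_field c X -> local_field c Y ->
    let T := loc id (coord c) (coord d) in
    forall x, locdom id (coord c) (coord d) x ->
      along (chr d) T X (push T Y) x = push T (cov (chr c) X Y) x }.

Definition nabla (n : nat) (M : manifold n) (D : connection M) (c : atlas M)
    (X Y : 'rV[R]_n -> 'rV[R]_n) : 'rV[R]_n -> 'rV[R]_n :=
  cov (D c) X Y.

Definition levi_civita (n : nat) (M : manifold n) (g : metric M)
    (D : connection M) : Prop :=
  forall (c : atlas M) X Y Z,
    local_field c X -> local_field c Y -> local_field c Z ->
  forall x, img c x ->
    nabla D c X Y x - nabla D c Y X x = bracket X Y x /\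
    'D_(X x) (fun y => g c y (Y y) (Z y) : R^o) x =
      g c x (nabla D c X Y x) (Z x) + g c x (Y x) (nabla D c X Z x).

Definition curvature (n : nat) (M : manifold n) (D : connection M)
    (c : atlas M) (X Y Z : 'rV[R]_n -> 'rV[R]_n) : 'rV[R]_n -> 'rV[R]_n :=
  fun x => nabla D c X (nabla D c Y Z) x - nabla D c Y (nabla D c X Z) x
           - nabla D c (bracket X Y) Z x.

(* The trace of X |-> R(X,Y)Z; a tangent vector u at x is extended by the     *)
(* field with constant coordinates u, R(X,Y)Z being tensorial in X.           *)
Definition ricci (n : nat) (M : manifold n) (D : connection M)
    (c : atlas M) (Y Z : 'rV[R]_n -> 'rV[R]_n) (x : 'rV[R]_n) : R :=
  \tr (lin1_mx (fun u => curvature D c (cst u) Y Z x)).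

Definition eta (n : nat) (M : manifold n) (g : metric M) (xi : vfield M)
    (c : atlas M) (x u : 'rV[R]_n) : R := g c x u (xi c x).

Definition phi (n : nat) (M : manifold n) (g : metric M) (xi : vfield M)
    (c : atlas M) (x u : 'rV[R]_n) : 'rV[R]_n :=
  u + eta g xi c x u *: xi c x.

Record lcs_structure (n : nat) (M : manifold n) (g : metric M)
    (D : connection M) (xi : vfield M) (alpha : M -> R) : Prop := LCS {
  lcs_connected : connected [set: M];
  lcs_lorentzian : lorentzian g;
  lcs_levi_civita : levi_civita g D;
  lcs_timelike : forall (c : atlas M) x, img c x -> g c x (xi c x) (xi c x) = -1;
  lcs_alpha_smooth : smooth_fun alpha;
  lcs_alpha_neq0 : forall p : M, alpha p != 0;
  lcs_nabla_xi : forall (c : atlas M) X, local_field c X ->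
    forall x, img c x ->
      nabla D c X (xi c) x = alpha (cinv (coord c) x) *: phi g xi c x (X x);
  lcs_dalpha : forall (c : atlas M) x, img c x ->
    let a := fun y => alpha (cinv (coord c) y) : R^o in
    forall u, 'D_u a x = (- 'D_(xi c x) a x) * eta g xi c x u }.

Definition quarter_symmetric (n : nat) (M : manifold n) (g : metric M)
    (D : connection M) (xi : vfield M) (Dq : connection M) : Prop :=
  forall (c : atlas M) X Y, local_field c X -> local_field c Y ->
  forall x, img c x ->
    nabla Dq c X Y x = nabla D c X Y x
      + eta g xi c x (Y x) *: phi g xi c x (X x)
      - g c x (phi g xi c x (X x)) (Y x) *: xi c x.

Section Submanifolds.
Variables (m n : nat) (M : manifold m) (N : manifold n) (iota : M -> N).

(* (Immersed) submanifolds, as injective immersions; embedded submanifolds    *)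
(* are a particular case.                                                     *)
Definition submanifold : Prop :=
  [/\ injective iota, continuous iota,
      forall (c : atlas M) (d : atlas N),
        smooth_on (locdom iota (coord c) (coord d))
                  (loc iota (coord c) (coord d)) &
      forall (c : atlas M) (d : atlas N) x, locdom iota (coord c) (coord d) x ->
        forall u, 'D_u (loc iota (coord c) (coord d)) x = 0 -> u = 0].

Definition induced_metric (g : metric N) (gM : metric M) : Prop :=
  forall (c : atlas M) (d : atlas N) x, locdom iota (coord c) (coord d) x ->
  let F := loc iota (coord c) (coord d) in
  forall u v, gM c x u v = g d (F x) ('D_u F x) ('D_v F x).

Definition restricts_to (xi : vfield N) (xiM : vfield M) : Prop :=
  forall (c : atlas M) (d : atlas N) x, locdom iota (coord c) (coord d) x ->
  let F := loc iota (coord c) (coord d) in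
  'D_(xiM c x) F x = xi d (F x).

Definition invariant_submanifold (g : metric N) (xi : vfield N) : Prop :=
  forall (c : atlas M) (d : atlas N) x, locdom iota (coord c) (coord d) x ->
  let F := loc iota (coord c) (coord d) in
  (exists u, 'D_u F x = xi d (F x)) /\
  (forall u, exists w, 'D_w F x = phi g xi d (F x) ('D_u F x)).

(* DM is the tangential part of D: the difference between D_X Y, computed     *)
(* along iota, and the tangent vector (DM)_X Y is normal to M.                *)
Definition induced_connection (g : metric N) (D : connection N)
    (DM : connection M) : Prop :=
  forall (c : atlas M) (d : atlas N) X Y, local_field c X -> local_field c Y ->
  let F := loc iota (coord c) (coord d) in
  forall x, locdom iota (coord c) (coord d) x ->
    let h := along (D d) F X (push F Y) x - push F (nabla DM c X Y) x in
    forall w, g d (F x) h ('D_w F x) = 0.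

End Submanifolds.

Definition ricci_soliton (m : nat) (M : manifold m) (g : metric M)
    (xi : vfield M) (D : connection M) (lambda : R) : Prop :=
  forall (c : atlas M) Y Z, local_field c Y -> local_field c Z ->
  forall x, img c x ->
    (g c x (nabla D c Y (xi c) x) (Z x) + g c x (Y x) (nabla D c Z (xi c) x))
    + 2 * ricci D c Y Z x + 2 * lambda * g c x (Y x) (Z x) = 0.

Definition eta_einstein (m : nat) (M : manifold m) (g : metric M)
    (xi : vfield M) (D : connection M) : Prop :=
  exists p q : M -> R, [/\ smooth_fun p, smooth_fun q &
    forall (c : atlas M) Y Z, local_field c Y -> local_field c Z ->
    forall x, img c x ->
      ricci D c Y Z x = p (cinv (coord c) x) * g c x (Y x) (Z x)
        + q (cinv (coord c) x) * (eta g xi c x (Y x) * eta g xi c x (Z x))].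

End Manifolds.

(* Main.v *)
From HB Require Import structures.
Require Import Defs.
From mathcomp Require Import all_boot all_order all_algebra.
From mathcomp Require Import all_classical all_reals all_analysis.
From mathcomp Require Import ring lra.
(* [coord] is to denote the charts of an atlas, not vector coordinates. *)
Import Defs.
Set Implicit Arguments.
Unset Strict Implicit.
Unset Printing Implicit Defensive.
Import Order.TTheory GRing.Theory Num.Theory.
Import numFieldNormedType.Exports.
Local Open Scope classical_set_scope.
Local Open Scope ring_scope.

(** The phi-terms of the quarter symmetric connection collapse: it is the
    Levi-Civita connection plus H, where H(X,Y) = eta(Y) X - g(X,Y) xi
    ([quarter_termE]).  Since xi is tangent to M and g restricts to M, the
    differential of the inclusion intertwines H on M with H on the ambient
    manifold.  Hence removing H from the induced connection leaves the
    tangential part of the ambient Levi-Civita connection, which is symmetric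
    and metric, and so is the Levi-Civita connection of M
    ([induced_minus_quarter_sym], [induced_minus_quarter_metric],
    [koszul_unique]).  Thus M carries the same picture: its induced connection
    is Levi-Civita plus H ([induced_quarter]).  Differentiating the relation
    between xi on M and xi along the inclusion gives moreover that the induced
    derivative of xi in the direction Y is (alpha - 1) phi Y
    ([induced_quarter_nabla_xi]), so that nabla_Y xi = alpha phi Y on M.

    The rest is intrinsic to M.  Comparing curvatures, every derivative of Y
    and Z cancels and only a term algebraic in g, eta and alpha survives
    ([curvature_quarter]).  Its trace, with m the dimension of M, yields
    ([ricci_quarter])

      Sbar = S + ((3 - 2m) alpha + m - 2) g
               + ((2 - m) alpha + m - 2) eta (x) eta,

    while the Lie derivative term of the soliton equation is
    2 (alpha - 1) (g + eta (x) eta).  Solving the soliton equation for S gives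

      S = ((2m - 4) alpha + 3 - m - lambda) g
          + ((m - 3) alpha + 3 - m) eta (x) eta,

    whose coefficients are affine in the restriction of alpha to M, and
    therefore smooth ([smooth_fun_comp]).

    Two facts of calculus are used on the way: the symmetry of second
    derivatives ([schwarz]), on which the symmetry of the tangential part
    rests, and the stability of the classes C^k under composition
    ([Ck_comp]). *)

(** * Differentiation of (bi)linear expressions *)

Section Differentiability.
Context {R : realType}.
Implicit Types V W : normedModType R.

(** The difference g - f vanishes near x, so its expansion at x is trivial. *)
Lemma near_eq_differentiable V W (f g : V -> W) (x : V) :
  {near x, f =1 g} -> differentiable f x -> differentiable g x.
Proof.
move=> fg df.
suff de : differentiable (g - f) x.
  have -> : g = (g - f) + f by rewrite subrK.
  exact: differentiableD.
have e0 : (g - f) \o shift x = cst ((g - f) x) + (\0 : V -> W) +o_ 0 id.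
  apply/eqaddoP => _/posnumP[e].
  have : \forall y \near 0, f (y + x) = g (y + x).
    move: fg; rewrite (near_shift 0); apply: filterS => y /=.
    by rewrite subr0.
  move=> h; near=> y.
  rewrite !fctE /= addr0 (nbhs_singleton fg) subrr.
  by rewrite (near h y)// subrr subr0 normr0 mulr_ge0.
have c0 : continuous (\0 : V -> W) by move=> y; exact: cvg_cst.
by apply/diff_locallyP; rewrite (diff_unique c0 e0).
Unshelve. all: by end_near. Qed.

Lemma derive_comp V V' W (f : V -> V') (g : V' -> W) x u :
  differentiable f x -> differentiable g (f x) ->
  'D_u (fun y => g (f y)) x = 'D_('D_u f x) g (f x).
Proof.
move=> df dg; rewrite !deriveE//; last exact: differentiable_comp.
by rewrite (@diff_comp _ _ _ _ f g).
Qed.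

Lemma derive_linear V W (f : V -> W) x : differentiable f x ->
  linear (fun u => 'D_u f x).
Proof. by move=> df a u v; rewrite !deriveE// linearP. Qed.

Lemma scale_bilinear W : bilinear_for *:%R *:%R (fun (k : R^o) (w : W) => k *: w).
Proof.
split=> [w|k] a x y /=; first by rewrite scalerDl scalerA.
by rewrite scalerDr !scalerA mulrC.
Qed.

(** Leibniz rule for a scalar function times a vector-valued one: the chain
    rule applied to the continuous bilinear map given by scaling. *)
Lemma is_diff_scale V W (k : V -> R^o) (f : V -> W) x :
  differentiable k x -> differentiable f x ->
  is_diff x (fun y => k y *: f y) (fun u => 'd k x u *: f x + k x *: 'd f x u).
Proof.
move=> dk df.
pose bM := @bilinear_isBilinear.Build R R^o W W _ _ _ (@scale_bilinear W).
pose b : {bilinear R^o -> W -> W} := HB.pack (fun (k : R^o) (w : W) => k *: w) bM.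
have bc : continuous (fun p : R^o * W => b p.1 p.2) by exact: (@scale_continuous R W).
have dp : is_diff x (fun y => (k y, f y)) (fun u => ('d k x u, 'd f x u)).
  by apply: is_diff_pair; exact: differentiableP.
have db : is_diff (k x, f x) (fun p : R^o * W => b p.1 p.2)
    (fun q => b (k x) q.2 + b q.1 (f x)).
  by apply: DiffDef; [exact: differentiable_bilin|rewrite diff_bilin].
apply: (is_diff_eq (is_diff_comp dp db)).
by apply/funext => u /=; rewrite addrC.
Qed.

Lemma open_near (T : topologicalType) (U : set T) (P : T -> Prop) x :
  open U -> U x -> (forall y, U y -> P y) -> \forall y \near x, P y.
Proof.
by move=> oU Ux UP; apply: filterS UP _; apply: open_nbhs_nbhs.
Qed.

Lemma linear_row_sum n W (f : 'rV[R]_n -> W) u : linear f ->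
  f u = \sum_j u 0 j *: f (delta_mx 0 j).
Proof.
move=> lf; pose fM := GRing.isLinear.Build _ _ _ _ f lf.
pose fL : {linear 'rV[R]_n -> W} := HB.pack f fM.
rewrite -[f]/(fL : _ -> _) {1}(row_sum_delta u) linear_sum.
by apply: eq_bigr => j _; rewrite linearZ.
Qed.

Lemma derive_coord m n V (A : V -> 'M[R]_(m, n)) i j x u : differentiable A x ->
  'D_u (fun y => A y i j : R^o) x = ('D_u A x) i j.
Proof. by move=> dA; rewrite derive_mx ?mxE//; exact: diff_derivable. Qed.

Lemma differentiable_entry m n V (A : V -> 'M[R]_(m, n)) i j x :
  differentiable A x -> differentiable (fun y => A y i j : R^o) x.
Proof.
move=> dA; apply: (@differentiable_comp _ _ _ _ A (fun N => N i j)) => //.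
exact: differentiable_coord.
Qed.

Lemma differentiable_scale V W (k : V -> R^o) (f : V -> W) x :
  differentiable k x -> differentiable f x ->
  differentiable (fun y => k y *: f y) x.
Proof. by move=> dk df; have [] := is_diff_scale dk df. Qed.

Lemma derive_scale V W (k : V -> R^o) (f : V -> W) x u :
  differentiable k x -> differentiable f x ->
  'D_u (fun y => k y *: f y) x = 'D_u k x *: f x + k x *: 'D_u f x.
Proof.
move=> dk df; rewrite !deriveE//; last exact: differentiable_scale.
by rewrite (@diff_val _ _ _ _ _ _ _ (is_diff_scale dk df)).
Qed.

(** Metric coefficients, Christoffel symbols and differentials are functions
    of a base point that are linear in their vector arguments, but only over
    the open image of a chart; whence the hypotheses near x.  Expanding the
    vector argument in the standard basis reduces the derivative of
    y |-> L y (A y) to the Leibniz rule. *)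
Section Linear.
Context {n : nat} {V W : normedModType R}.
Variables (L : V -> 'rV[R]_n -> W) (A : V -> 'rV[R]_n) (x : V).
Hypothesis linL : \forall y \near x, linear (L y).
Hypothesis dL : forall a, differentiable (L^~ a) x.
Hypothesis dA : differentiable A x.

Let expand (B : V -> 'rV[R]_n) : {near x, (\sum_(j < n)
   (fun y => (B y 0 j : R^o) *: L y (delta_mx 0 j))) =1 (fun y => L y (B y))}.
Proof.
apply: filterS linL => y linLy.
by rewrite fct_sumE (linear_row_sum (B y) linLy).
Qed.

Lemma differentiable_linear_arg : differentiable (fun y => L y (A y)) x.
Proof.
apply: near_eq_differentiable (expand A) _; apply: differentiable_sum => j.
by apply: differentiable_scale => //; exact: differentiable_entry.
Qed.

Lemma derive_linear_arg u :
  'D_u (fun y => L y (A y)) x = 'D_u (L^~ (A x)) x + L x ('D_u A x).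
Proof.
rewrite -(near_eq_derive _ (expand A)) -(near_eq_derive _ (expand (cst (A x)))).
rewrite (linear_row_sum ('D_u A x) (nbhs_singleton linL)).
have dterm (B : V -> 'rV[R]_n) j : differentiable B x ->
    differentiable (fun y => (B y 0 j : R^o) *: L y (delta_mx 0 j)) x.
  by move=> dB; apply: differentiable_scale => //; exact: differentiable_entry.
rewrite !derive_sum; last 2 first.
- by move=> j; apply: diff_derivable; exact: dterm.
- by move=> j; apply: diff_derivable; apply: dterm.
rewrite -big_split; apply: eq_bigr => j _ /=.
rewrite (derive_scale _ (differentiable_entry 0 j dA) (dL _)).
rewrite (derive_scale _ (differentiable_cst (A x 0 j : R^o) x) (dL _)).
by rewrite derive_coord// derive_cst scale0r add0r addrC.
Qed.

End Linear.

(** Freezing one argument at a time reduces the bilinear case to the linear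
    one. *)
Section Bilinear.
Context {n p : nat} {V W : normedModType R}.
Variables (B : V -> 'rV[R]_n -> 'rV[R]_p -> W).
Variables (A : V -> 'rV[R]_n) (C : V -> 'rV[R]_p) (x : V).
Hypothesis linl : \forall y \near x, forall c, linear (B y ^~ c).
Hypothesis linr : \forall y \near x, forall a, linear (B y a).
Hypothesis dB : forall a c, differentiable (fun y => B y a c) x.
Hypothesis dA : differentiable A x.
Hypothesis dC : differentiable C x.

Let dBC a : differentiable (fun y => B y a (C y)) x.
Proof.
apply: (@differentiable_linear_arg _ _ _ (fun y c => B y a c)) => //.
by apply: filterS linr => y; exact.
Qed.

Lemma differentiable_bilinear_arg : differentiable (fun y => B y (A y) (C y)) x.
Proof.
apply: (@differentiable_linear_arg _ _ _ (fun y a => B y a (C y))) => //.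
by apply: filterS linl => y; exact.
Qed.

Lemma derive_bilinear_arg u : 'D_u (fun y => B y (A y) (C y)) x =
  'D_u (fun y => B y (A x) (C x)) x + B x ('D_u A x) (C x)
    + B x (A x) ('D_u C x).
Proof.
rewrite (@derive_linear_arg _ _ _ (fun y a => B y a (C y))) //; last first.
  by apply: filterS linl => y; exact.
rewrite (@derive_linear_arg _ _ _ (fun y c => B y (A x) c)) 1?addrAC //.
by apply: filterS linr => y; exact.
Qed.

End Bilinear.
End Differentiability.

(** * Symmetry of second derivatives *)

Section Schwarz.
Context {R : realType} {V : normedModType R}.

Lemma MVT_along (f : V -> R^o) (y v : V) (s : R) : 0 < s ->
  (forall t, 0 <= t <= s -> differentiable f (y + t *: v)) ->
  exists2 t, 0 <= t <= s & f (y + s *: v) - f y = s * 'D_v f (y + t *: v).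
Proof.
move=> s0 df; pose h (t : R) := y + t *: v.
have dh (t : R) : is_diff (t : R^o) (h : R^o -> V) ( *:%R^~ v).
  have -> : (h : R^o -> V) = cst y + ( *:%R^~ v) by [].
  by apply: is_diff_eq; rewrite add0r.
have Dh (t : R) : 'D_1 h t = v by rewrite deriveE// diff_val scale1r.
have dfh t : 0 <= t <= s -> differentiable (f \o h) t.
  by move=> ts; apply: differentiable_comp => //; exact: df.
have sub t : t \in `]0, s[ -> 0 <= t <= s.
  by rewrite in_itv/= => /andP[t0 ts]; rewrite !ltW.
have Dfh t : t \in `]0, s[ -> is_derive t (1 : R) (f \o h : R -> R) ('D_v f (h t)).
  move=> /sub ts; apply: DeriveDef; first exact/diff_derivable/dfh.
  by rewrite (@derive_comp _ _ _ _ h f) ?Dh//; exact: df.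
have cfh : {within `[0, s], continuous (f \o h : R -> R)}.
  apply: continuous_in_subspaceT => t; rewrite inE/= in_itv/= => ts.
  exact/differentiable_continuous/dfh.
have [t /sub ts] := MVT s0 Dfh cfh.
rewrite /h /= scale0r addr0 subr0 mulrC => E.
by exists t.
Qed.

(** The second difference of f on a parallelogram is computed by applying the
    mean value theorem first to y |-> f (y + s v) - f y along u, and then to
    the derivative of f in the direction u, along v. *)
Lemma second_difference (f : V -> R^o) (x u v : V) (s : R) : 0 < s ->
  (forall a b, 0 <= a <= s -> 0 <= b <= s ->
    differentiable f (x + a *: u + b *: v) /\
    differentiable ('D_u f) (x + a *: u + b *: v)) ->
  exists a b, [/\ 0 <= a <= s, 0 <= b <= s &
    (f (x + s *: u + s *: v) - f (x + s *: u)) - (f (x + s *: v) - f x)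
      = s * (s * 'D_v ('D_u f) (x + a *: u + b *: v))].
Proof.
move=> s0 df; pose h (y : V) : R^o := f (y + s *: v) - f y.
have dshift y : is_diff y (fun z : V => z + s *: v) id.
  have -> : (fun z : V => z + s *: v) = id + cst (s *: v) by [].
  by apply: is_diff_eq; rewrite addr0.
have s_in : 0 <= s <= s by rewrite ltW//=.
have z_in : 0 <= (0 : R) <= s by rewrite lexx ltW.
have d1 a : 0 <= a <= s -> differentiable f (x + a *: u).
  by move=> /df/(_ z_in)[]; rewrite scale0r addr0.
have d2 a : 0 <= a <= s ->
    differentiable (fun y => f (y + s *: v)) (x + a *: u).
  move=> as_; apply: (@differentiable_comp _ _ _ _ (fun z => z + s *: v)) => //.
  by have [] := df _ _ as_ s_in.
have dh a : 0 <= a <= s -> differentiable h (x + a *: u).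
  by move=> as_; apply: differentiableB; [exact: d2|exact: d1].
have [a as_] := MVT_along s0 dh.
have Dshift : 'D_u (fun y => f (y + s *: v)) (x + a *: u) =
    'D_u f (x + a *: u + s *: v).
  have dshifted := (df _ _ as_ s_in).1.
  rewrite (derive_comp u (@ex_diff _ _ _ _ _ _ _ (dshift _)) dshifted).
  by rewrite (deriveE _ (@ex_diff _ _ _ _ _ _ _ (dshift _))) diff_val.
have -> : 'D_u h (x + a *: u) =
    'D_u f (x + a *: u + s *: v) - 'D_u f (x + a *: u).
  rewrite deriveB ?Dshift//.
  - by apply: diff_derivable; exact: d2.
  - by apply: diff_derivable; exact: d1.
have [b bs ->] := @MVT_along ('D_u f) (x + a *: u) v s s0
  (fun b bs => (df a b as_ bs).2).
by move=> e; exists a, b; split.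
Qed.

Let swap_ends (a b c d p q : R) :
  a - b - (c - d) = p -> a - c - (b - d) = q -> p = q.
Proof. by move=> <- <-; ring. Qed.

Let close_to_equal (a b c d e : R) :
  c = d -> `|a - c| < e / 2 -> `|b - d| < e / 2 -> `|a - b| <= e.
Proof.
move=> -> ad bd; rewrite -(subrKA d) (splitr e) (le_trans (ler_normD _ _))//.
by rewrite lerD// ltW// distrC.
Qed.

(** The second difference over the parallelogram spanned by s u and s v does
    not depend on the order of u and v.  It equals s^2 times either mixed
    derivative at a nearby point, and both mixed derivatives are continuous
    at x. *)
Lemma schwarz_scalar (U : set V) (f : V -> R^o) (x u v : V) : open U -> U x ->
  (forall y, U y -> [/\ differentiable f y, differentiable ('D_u f) y &
     differentiable ('D_v f) y]) ->
  {for x, continuous ('D_v ('D_u f))} -> {for x, continuous ('D_u ('D_v f))} ->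
  'D_v ('D_u f) x = 'D_u ('D_v f) x.
Proof.
move=> oU Ux df cvu cuv; apply/eqP; rewrite -subr_eq0 -normr_eq0.
apply/eqP/le_anti; rewrite normr_ge0 andbT; apply/ler_addgt0Pl => e e0.
rewrite addr0.
have e2 : 0 < e / 2 by rewrite divr_gt0.
move/cvgrPdist_lt : cvu => /(_ _ e2) near_vu.
move/cvgrPdist_lt : cuv => /(_ _ e2) near_uv.
have nP := filterI (filterI (open_nbhs_nbhs (conj oU Ux)) near_vu) near_uv.
have [r /= r0 rP] := (nbhs_ballP _ _).1 (nP _ _).
pose k := `|u| + `|v| + 1.
have k0 : 0 < k by rewrite ltr_wpDl// addr_ge0.
(* with this side, the whole parallelogram at x lies in the ball of radius r *)
pose s := r / k.
have s0 : 0 < s by rewrite divr_gt0.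
have near_x a b : 0 <= a <= s -> 0 <= b <= s -> ball x r (x + a *: u + b *: v).
  move=> /andP[a0 as_] /andP[b0 bs].
  rewrite -ball_normE /= -addrA opprD addrA subrr sub0r normrN.
  apply: (le_lt_trans (ler_normD _ _)); rewrite !normrZ !ger0_norm//.
  apply: (@le_lt_trans _ _ (s * `|u| + s * `|v|)).
    by apply: lerD; exact: ler_wpM2r.
  by rewrite -mulrDr /s -mulrA gtr_pMr// ltr_pdivrMl// mulr1 ltrDl.
have near_x' a b : 0 <= a <= s -> 0 <= b <= s -> ball x r (x + b *: v + a *: u).
  by move=> aP bP; rewrite addrAC; exact: near_x.
have [a [b [aP bP E1]]] : exists a b, [/\ 0 <= a <= s, 0 <= b <= s &
    (f (x + s *: u + s *: v) - f (x + s *: u)) - (f (x + s *: v) - f x)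
      = s * (s * 'D_v ('D_u f) (x + a *: u + b *: v))].
  apply: second_difference => // a b aP bP.
  by have /rP[[/df[]]] := near_x _ _ aP bP.
have [c [d [cP dP E2]]] : exists a b, [/\ 0 <= a <= s, 0 <= b <= s &
    (f (x + s *: v + s *: u) - f (x + s *: v)) - (f (x + s *: u) - f x)
      = s * (s * 'D_u ('D_v f) (x + a *: v + b *: u))].
  apply: second_difference => // c d cP dP.
  by have /rP[[/df[]]] := near_x' _ _ dP cP.
have E : s * (s * 'D_v ('D_u f) (x + a *: u + b *: v)) =
    s * (s * 'D_u ('D_v f) (x + c *: v + d *: u)).
  by rewrite [x + s *: v + s *: u]addrAC in E2; exact: (swap_ends E1 E2).
have /rP[[_ h1] _] := near_x _ _ aP bP.
have /rP[_ h2] := near_x' _ _ dP cP.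
exact: (close_to_equal (mulfI (lt0r_neq0 s0) (mulfI (lt0r_neq0 s0) E)) h1 h2).
Qed.

End Schwarz.

(** * The classes C^k *)

Section Smooth.
Context {R : realType}.
Implicit Types V W : normedModType R.

Lemma CkS V W k (U : set V) (f : V -> W) : Ck k.+1 U f -> Ck k U f.
Proof.
elim: k f => [|k IH] f [df Df]; first by move=> x /df; exact: differentiable_continuous.
by split=> // v; apply: IH; exact: Df.
Qed.

Lemma eq_Ck V W k (U : set V) (f f' : V -> W) : open U ->
  (forall x, U x -> f x = f' x) -> Ck k U f -> Ck k U f'.
Proof.
move=> oU; elim: k f f' => [|k IH] f f' ff' /=.
  move=> cf x Ux; suff : f' @ x --> f x by rewrite (ff' x Ux).
  apply: cvg_trans (cf x Ux); apply: near_eq_cvg.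
  by apply: open_near oU Ux _ => y Uy; rewrite ff'.
case=> df Df; split=> [x Ux|v].
  by apply: near_eq_differentiable (df x Ux); exact: open_near oU Ux _.
apply: IH (Df v) => x Ux.
by apply: near_eq_derive; exact: open_near oU Ux _.
Qed.

Lemma Ck_local V W k (U : set V) (f : V -> W) :
  (forall x, U x -> exists U', [/\ open U', U' x & Ck k U' f]) -> Ck k U f.
Proof.
elim: k f => [|k IH] f Uf /=.
  by move=> x /Uf[U' [_ U'x]]; exact.
split=> [x Ux|v].
  by have [U' [_ U'x [df _]]] := Uf x Ux; exact: (df x U'x).
by apply: IH => x /Uf[U' [oU' U'x [_ Df]]]; exists U'; split=> //; exact: Df.
Qed.

Lemma Ck_cst V W k (U : set V) (w : W) : Ck k U (cst w).
Proof.
elim: k w => [|k IH] w /=; first by move=> x _; exact: cst_continuous.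
split=> [x _|v]; first exact: differentiable_cst.
rewrite (_ : (fun x => _) = cst 0)//.
by apply/funext => x; rewrite derive_cst.
Qed.

Lemma CkD V W k (U : set V) (f f' : V -> W) : open U ->
  Ck k U f -> Ck k U f' -> Ck k U (fun x => f x + f' x).
Proof.
move=> oU; elim: k f f' => [|k IH] f f' /=.
  by move=> cf cf' x Ux; apply: continuousD; [exact: cf|exact: cf'].
move=> [df Df] [df' Df']; split=> [x Ux|v].
  by apply: differentiableD; [exact: df|exact: df'].
apply: eq_Ck (IH _ _ (Df v) (Df' v)) => // x Ux.
by rewrite deriveD//; apply: diff_derivable; [exact: df|exact: df'].
Qed.

Lemma Ck_scale V W k (U : set V) (a : V -> R^o) (f : V -> W) : open U ->
  Ck k U a -> Ck k U f -> Ck k U (fun x => a x *: f x).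
Proof.
move=> oU; elim: k a f => [|k IH] a f.
  by move=> ca cf x Ux; apply: cvgZ; [exact: ca|exact: cf].
move=> Ca Cf; have [da Da] := Ca; have [df Df] := Cf; split=> [x Ux|v].
  by apply: differentiable_scale; [exact: da|exact: df].
apply: (@eq_Ck _ _ _ _ (fun x => 'D_v a x *: f x + a x *: 'D_v f x)) => //.
  by move=> x Ux; rewrite (derive_scale v (da x Ux) (df x Ux)).
apply: CkD => //; first by apply: IH; [exact: Da|exact: CkS].
by apply: IH; [exact: CkS|exact: Df].
Qed.

Lemma Ck_sum V W k (U : set V) n (f : 'I_n -> V -> W) : open U ->
  (forall j, Ck k U (f j)) -> Ck k U (fun x => \sum_j f j x).
Proof.
move=> oU Cf; elim: n f Cf => [|n IH] f Cf.
  rewrite (_ : (fun x => _) = cst 0); first exact: Ck_cst.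
  by apply/funext => x; rewrite big_ord0.
rewrite (_ : (fun x => _) = (fun x => f ord0 x + \sum_j f (lift ord0 j) x)).
  by apply: CkD => //; exact: IH.
by apply/funext => x; rewrite big_ord_recl.
Qed.

Lemma Ck_entry m n V k (U : set V) (A : V -> 'M[R]_(m, n)) i j : open U ->
  Ck k U A -> Ck k U (fun x => A x i j : R^o).
Proof.
move=> oU; elim: k A => [|k IH] A /=.
  move=> cA x Ux.
  apply: (@continuous_comp _ _ _ A (fun N : 'M[R]_(m, n) => N i j)).
    exact: cA.
  exact: coord_continuous.
move=> [dA DA]; split=> [x Ux|v]; first exact/differentiable_entry/dA.
apply: eq_Ck (IH _ (DA v)) => // x Ux.
by rewrite derive_coord//; exact: dA.
Qed.

(** The derivative of f o F in the direction v is the sum of the products of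
    the components of D_v F with the partial derivatives of f along F, so
    induction on k applies to the partial derivatives of f. *)
Lemma Ck_comp m V W k (U : set V) (U' : set 'rV[R]_m) (F : V -> 'rV[R]_m)
    (f : 'rV[R]_m -> W) : open U -> (forall x, U x -> U' (F x)) ->
  Ck k U F -> Ck k U' f -> Ck k U (fun x => f (F x)).
Proof.
move=> oU FU; elim: k f => [|k IH] f.
  move=> cF cf x Ux; apply: (@continuous_comp _ _ _ F f); first exact: cF.
  by apply: cf; exact: FU.
move=> CF [df Df]; have [dF DF] := CF; split=> [x Ux|v].
  by apply: differentiable_comp; [exact: dF|apply: df; exact: FU].
apply: (@eq_Ck _ _ _ _
    (fun x => \sum_j ('D_v F x 0 j : R^o) *: 'D_(delta_mx 0 j) f (F x))) => //.
  move=> x Ux; have dfx := df _ (FU x Ux).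
  rewrite (derive_comp v (dF x Ux) dfx).
  by rewrite (linear_row_sum ('D_v F x) (derive_linear dfx)).
apply: Ck_sum => // j; apply: Ck_scale => //.
  by apply: Ck_entry => //; exact: DF.
by apply: (IH ('D_(delta_mx 0 j) f)); [exact: CkS|exact: Df].
Qed.

Lemma smooth_differentiable V W (U : set V) (f : V -> W) x :
  smooth_on U f -> U x -> differentiable f x.
Proof. by move=> /(_ 1%N)[+ _]; exact. Qed.

Lemma smooth_derive V W (U : set V) (f : V -> W) v :
  smooth_on U f -> smooth_on U ('D_v f).
Proof. by move=> sf k; have [_] := sf k.+1; exact. Qed.

Lemma smooth_cst V W (U : set V) (w : W) : smooth_on U (cst w).
Proof. by move=> k; exact: Ck_cst. Qed.

Lemma schwarz V n (U : set V) (F : V -> 'rV[R]_n) x u v : open U -> U x ->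
  smooth_on U F -> 'D_v ('D_u F) x = 'D_u ('D_v F) x.
Proof.
move=> oU Ux sF; apply/rowP => j.
have sFj : smooth_on U (fun y => F y 0 j : R^o) by move=> k; exact: Ck_entry.
have dF y : U y -> differentiable F y by exact: smooth_differentiable sF.
have dDF b : differentiable ('D_b F) x.
  exact: smooth_differentiable (smooth_derive b sF) Ux.
have entry a b :
    ('D_a ('D_b F) x) 0 j = 'D_a ('D_b (fun y => F y 0 j : R^o)) x.
  rewrite -(derive_coord 0 j a (dDF b)).
  apply: near_eq_derive; apply: open_near oU Ux _ => y Uy.
  by rewrite (derive_coord 0 j b (dF y Uy)).
apply: (etrans (entry v u)); apply/esym/(etrans (entry u v))/esym.
apply: (schwarz_scalar oU Ux).
- move=> y Uy; split; first exact: smooth_differentiable sFj Uy.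
    exact: smooth_differentiable (smooth_derive u sFj) Uy.
  exact: smooth_differentiable (smooth_derive v sFj) Uy.
- exact: (smooth_derive v (smooth_derive u sFj) 0%N x Ux).
- exact: (smooth_derive u (smooth_derive v sFj) 0%N x Ux).
Qed.

End Smooth.

(** * Metrics and the Levi-Civita connection in a chart *)

Section MetricAlgebra.
Context {R : realType} {m : nat} {M : manifold R m}.
Variables (g : metric M) (xi : vfield M) (c : atlas M).

Lemma img_open : open (img c).
Proof. exact: cimg_open. Qed.

Lemma metric_linearl x v : img c x -> linear (fun u => g c x u v : R^o).
Proof. by move=> hx a u1 u2; exact: gf_linear. Qed.

Lemma metric_linearr x u : img c x -> linear (fun v => g c x u v : R^o).
Proof.
by move=> hx a v1 v2; rewrite !(gf_sym g hx u); exact: gf_linear.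
Qed.

Section Pointwise.
Variables (x : 'rV[R]_m) (hx : img c x).

Lemma metricDl u1 u2 v : g c x (u1 + u2) v = g c x u1 v + g c x u2 v.
Proof. by have := gf_linear g hx 1 u1 u2 v; rewrite scale1r mul1r. Qed.

Lemma metric0l v : g c x 0 v = 0.
Proof.
apply: (addrI (g c x 0 v)); rewrite -metricDl !addr0//.
Qed.

Lemma metricZl a u v : g c x (a *: u) v = a * g c x u v.
Proof. by have := gf_linear g hx a u 0 v; rewrite metric0l !addr0. Qed.

Lemma metricBl u1 u2 v : g c x (u1 - u2) v = g c x u1 v - g c x u2 v.
Proof. by rewrite -scaleN1r metricDl metricZl mulN1r. Qed.

Lemma metricDr u v1 v2 : g c x u (v1 + v2) = g c x u v1 + g c x u v2.
Proof. by rewrite !(gf_sym g hx u) metricDl. Qed.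

Lemma metricZr a u v : g c x u (a *: v) = a * g c x u v.
Proof. by rewrite !(gf_sym g hx u) metricZl. Qed.

Lemma metricBr u v1 v2 : g c x u (v1 - v2) = g c x u v1 - g c x u v2.
Proof. by rewrite !(gf_sym g hx u) metricBl. Qed.

Lemma metric_split u v p q r s :
  g c x p v + g c x u q + g c x r v + g c x u s
    = g c x (r + p) v + g c x (s + q) u.
Proof. by rewrite !metricDl !(gf_sym g hx u); ring. Qed.

Lemma metric_inj u1 u2 :
  (forall v, g c x u1 v = g c x u2 v) -> u1 = u2.
Proof.
move=> E; apply/subr0_eq/(@gf_nondeg _ _ _ g c x hx) => v; rewrite metricBl E.
exact: subrr.
Qed.

End Pointwise.

(** The difference between the quarter symmetric connection and the
    Levi-Civita connection, by [quarter_termE]: in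
    eta(v) phi u - g(phi u, v) xi the terms in eta(u) eta(v) xi cancel. *)
Definition quarter_term x u v : 'rV[R]_m :=
  eta g xi c x v *: u - g c x u v *: xi c x.

Lemma quarter_termE x u v : img c x ->
  eta g xi c x v *: phi g xi c x u - g c x (phi g xi c x u) v *: xi c x
    = quarter_term x u v.
Proof.
move=> hx; rewrite /quarter_term /phi metricDl// metricZl//.
rewrite (gf_sym g hx (xi c x)) -/(eta g xi c x v).
by apply/rowP => j; rewrite !mxE; ring.
Qed.

End MetricAlgebra.
Arguments img_open {R m M} c.
Arguments metric_inj {R m M} g {c x}.

Section KoszulUniqueness.
Context {R : realType} {m : nat} {M : manifold R m} (g : metric M).

(** Uniqueness of the Levi-Civita connection.  The trilinear form
    g(S(u,v) - T(u,v), w) is symmetric in u, v and skew in v, w, hence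
    zero. *)
Lemma koszul_unique (c : atlas M) x (S T : 'rV[R]_m -> 'rV[R]_m -> 'rV[R]_m) :
  img c x -> (forall u v, S u v = S v u) -> (forall u v, T u v = T v u) ->
  (forall w u v, g c x (S w u) v + g c x u (S w v)
               = g c x (T w u) v + g c x u (T w v)) ->
  forall u v, S u v = T u v.
Proof.
move=> hx symS symT ST u v; apply: (metric_inj g hx) => w.
have skew a b e : g c x (S a b) e + g c x (S a e) b =
    g c x (T a b) e + g c x (T a e) b.
  by have := ST a b e; rewrite !(gf_sym g hx b).
have := (skew u v w, skew v u w, skew w u v) => -[[]].
rewrite (symS v u) (symT v u) (symS w u) (symT w u) (symS w v) (symT w v).
lra.
Qed.

End KoszulUniqueness.

Section LeviCivita.
Context {R : realType} {m : nat} {M : manifold R m}.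
Variables (g : metric M) (D : connection M) (c : atlas M).

Lemma nabla_cst x u v : nabla D c (cst u) (cst v) x = D c x u v.
Proof. by rewrite /nabla /cov derive_cst add0r. Qed.

Hypothesis LC : levi_civita g D.

Lemma levi_civita_sym x u v : img c x -> D c x u v = D c x v u.
Proof.
move=> hx; have s w : local_field c (cst w) by exact: smooth_cst.
have [+ _] := LC (s u) (s v) (s 0) hx.
by rewrite !nabla_cst /bracket !derive_cst subrr => /subr0_eq.
Qed.

Lemma levi_civita_metric x w u v : img c x ->
  'D_w (fun y => g c y u v : R^o) x
    = g c x (D c x w u) v + g c x u (D c x w v).
Proof.
move=> hx; have s e : local_field c (cst e) by exact: smooth_cst.
by have [_] := LC (s w) (s u) (s v) hx; rewrite !nabla_cst.
Qed.

Lemma metric_differentiable x u v : img c x ->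
  differentiable (fun y => g c y u v : R^o) x.
Proof. by move=> hx; exact: (smooth_differentiable (gf_smooth g c u v) hx). Qed.

(** Compatibility with the metric extends from constant fields to
    differentiable ones by bilinearity. *)
Lemma derive_metric x w (A B : 'rV[R]_m -> 'rV[R]_m) : img c x ->
  differentiable A x -> differentiable B x ->
  'D_w (fun y => g c y (A y) (B y) : R^o) x
    = g c x (nabla D c (cst w) A x) (B x) + g c x (A x) (nabla D c (cst w) B x).
Proof.
move=> hx dA dB.
rewrite (@derive_bilinear_arg _ _ _ _ R^o (fun y a b => g c y a b) A B x)//.
- rewrite (levi_civita_metric _ _ _ hx) /nabla /cov /= metricDl// metricDr//.
  ring.
- by apply: (open_near (img_open c) hx) => y hy e; exact: metric_linearl.
- by apply: (open_near (img_open c) hx) => y hy e; exact: metric_linearr.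
- by move=> a b; exact: metric_differentiable.
Qed.

Lemma differentiable_metric x (A B : 'rV[R]_m -> 'rV[R]_m) : img c x ->
  differentiable A x -> differentiable B x ->
  differentiable (fun y => g c y (A y) (B y) : R^o) x.
Proof.
move=> hx dA dB.
apply: (@differentiable_bilinear_arg _ _ _ _ R^o (fun y a b => g c y a b)) => //.
- by apply: (open_near (img_open c) hx) => y hy e; exact: metric_linearl.
- by apply: (open_near (img_open c) hx) => y hy e; exact: metric_linearr.
- by move=> a b; exact: metric_differentiable.
Qed.

End LeviCivita.

(** * The connection induced on the submanifold *)

Section Submanifold.
Context {R : realType} {m n : nat} {M : manifold R m} {N : manifold R n}.
Variable (iota : M -> N).
Hypothesis sub : submanifold iota.

Lemma locdom_open (c : atlas M) (d : atlas N) :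
  open (locdom iota (coord c) (coord d)).
Proof.
have [_ ciota _ _] := sub.
rewrite openE => x [hx hd]; apply: filterI.
  by apply: open_nbhs_nbhs; split=> //; exact: cimg_open.
have cF : {for x, continuous (fun y => iota (cinv (coord c) y))}.
  apply: (@continuous_comp _ _ _ (cinv (coord c)) iota).
    exact: cinv_continuous.
  exact: ciota.
by apply: cF; apply: open_nbhs_nbhs; split=> //; exact: cdom_open.
Qed.

Arguments locdom_open c d : clear implicits.

Lemma locdom_img (c : atlas M) (d : atlas N) x :
  locdom iota (coord c) (coord d) x -> img d (loc iota (coord c) (coord d) x).
Proof. by case=> _ hd; exact: cmap_img. Qed.

Lemma locdom_cover (c : atlas M) x : img c x ->
  exists d : atlas N, locdom iota (coord c) (coord d) x.
Proof.
by move=> hx; have [d hd] := atlas_cover (iota (cinv (coord c) x)); exists d.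
Qed.

(** Smoothness is local, and near each point of M the inclusion is read in a
    single ambient chart, where [Ck_comp] applies. *)
Lemma smooth_fun_comp (f : N -> R) : smooth_fun f ->
  smooth_fun (fun p => f (iota p)).
Proof.
move=> sf c k; have [_ _ sF _] := sub.
apply: Ck_local => x /locdom_cover[d hx].
exists (locdom iota (coord c) (coord d)); split=> //; first exact: locdom_open.
apply: (@eq_Ck _ _ _ _ _ (fun y =>
    f (cinv (coord d) (loc iota (coord c) (coord d) y)) : R^o)).
- exact: locdom_open.
- by move=> y [_ hd]; rewrite /loc cmapK.
- apply: (@Ck_comp _ _ _ _ _ _ (img d) (loc iota (coord c) (coord d))
    (fun z => f (cinv (coord d) z) : R^o)).
  + exact: locdom_open.
  + by move=> y hy; exact: locdom_img.
  + exact: sF.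
  + exact: sf.
Qed.

Variables (g : metric N) (gM : metric M) (xi : vfield N) (xiM : vfield M).
Hypothesis hgM : induced_metric iota g gM.
Hypothesis hxiM : restricts_to iota xi xiM.

Section Charts.
Variables (c : atlas M) (d : atlas N) (x : 'rV[R]_m).
Hypothesis hx : locdom iota (coord c) (coord d) x.
Local Notation F := (loc iota (coord c) (coord d)).

Let hcx : img c x. Proof. by case: hx. Qed.
Let hdF : img d (F x). Proof. exact: locdom_img. Qed.
Let sF : smooth_on (locdom iota (coord c) (coord d)) F.
Proof. by case: sub. Qed.
Let dF : differentiable F x. Proof. exact: smooth_differentiable sF hx. Qed.

Let dFlin : linear (fun u => 'D_u F x). Proof. exact: derive_linear. Qed.

Let dFZ a u : 'D_(a *: u) F x = a *: 'D_u F x.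
Proof. by have := dFlin a u 0; rewrite derive0 !addr0. Qed.

Let dFD u v : 'D_(u + v) F x = 'D_u F x + 'D_v F x.
Proof. by have := dFlin 1 u v; rewrite !scale1r. Qed.

Let dFB u v : 'D_(u - v) F x = 'D_u F x - 'D_v F x.
Proof. by rewrite -(scaleN1r v) dFD dFZ scaleN1r. Qed.

Lemma eta_restrict u : eta gM xiM c x u = eta g xi d (F x) ('D_u F x).
Proof. by rewrite /eta (hgM hx) (hxiM hx). Qed.

Lemma phi_restrict u :
  'D_(phi gM xiM c x u) F x = phi g xi d (F x) ('D_u F x).
Proof. by rewrite /phi dFD dFZ (hxiM hx) eta_restrict. Qed.

Lemma quarter_term_restrict u v : 'D_(quarter_term gM xiM c x u v) F x
  = quarter_term g xi d (F x) ('D_u F x) ('D_v F x).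
Proof.
by rewrite /quarter_term dFB !dFZ (hxiM hx) eta_restrict (hgM hx).
Qed.

Variables (D Dq : connection N) (DqM : connection M).
Hypothesis LC : levi_civita g D.
Hypothesis hDq : quarter_symmetric g D xi Dq.
Hypothesis hDqM : induced_connection iota g Dq DqM.

Lemma quarter_chr y u v : img d y ->
  Dq d y u v = D d y u v + quarter_term g xi d y u v.
Proof.
move=> hy; have s w : local_field d (cst w) by exact: smooth_cst.
have := hDq (s u) (s v) hy; rewrite !nabla_cst -addrA => ->.
by rewrite quarter_termE.
Qed.

(** Removing H from the induced connection leaves the tangential part of the
    ambient Levi-Civita connection: H is natural for the inclusion, by
    [quarter_term_restrict], so that it cancels on both sides. *)
Lemma induced_minus_quarter u v w :
  gM c x (DqM c x u v - quarter_term gM xiM c x u v) w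
    = g d (F x) ('D_u ('D_v F) x + D d (F x) ('D_u F x) ('D_v F x)) ('D_w F x).
Proof.
have s e : local_field c (cst e) by exact: smooth_cst.
have := hDqM (s u) (s v) hx w; rewrite /along /push /= nabla_cst.
rewrite (quarter_chr _ _ hdF) -quarter_term_restrict metricBl//.
move/subr0_eq => E; rewrite (metricBl gM hcx) !(hgM hx) -E -(metricBl g hdF).
by rewrite addrA addrK.
Qed.

(** The symmetry of the second derivatives of the inclusion and that of the
    ambient Christoffel symbols. *)
Lemma induced_minus_quarter_sym u v :
  DqM c x u v - quarter_term gM xiM c x u v
    = DqM c x v u - quarter_term gM xiM c x v u.
Proof.
apply: (metric_inj gM hcx) => w; rewrite !induced_minus_quarter.
rewrite (schwarz v u (locdom_open c d) hx sF).
by rewrite (levi_civita_sym LC _ _ hdF).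
Qed.

(** Differentiating g(dF u, dF v) along the inclusion produces the derivative
    of the ambient metric, expressed by the ambient Levi-Civita connection,
    and the second derivatives of F; together they make up the right-hand
    sides of [induced_minus_quarter]. *)
Lemma induced_minus_quarter_metric w u v :
  'D_w (fun y => gM c y u v : R^o) x
    = gM c x (DqM c x w u - quarter_term gM xiM c x w u) v
      + gM c x u (DqM c x w v - quarter_term gM xiM c x w v).
Proof.
pose G y a b : R^o := g d (F y) a b.
have dG a b : differentiable (fun y => G y a b) x.
  apply: (@differentiable_comp _ _ _ _ F (fun z => g d z a b : R^o)) => //.
  exact: metric_differentiable.
have DG a b : 'D_w (fun y => G y a b) x =
    'D_('D_w F x) (fun z => g d z a b : R^o) (F x).
  apply: (@derive_comp _ _ _ _ F (fun z => g d z a b : R^o)) => //.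
  exact: metric_differentiable.
have dDF e : differentiable ('D_e F) x.
  exact: smooth_differentiable (smooth_derive e sF) hx.
have -> : 'D_w (fun y => gM c y u v : R^o) x =
    'D_w (fun y => G y ('D_u F y) ('D_v F y)) x.
  apply: near_eq_derive; apply: (open_near (locdom_open c d) hx) => y hy.
  exact: hgM.
rewrite (@derive_bilinear_arg _ _ _ _ R^o G ('D_u F) ('D_v F) x)//.
- rewrite DG (levi_civita_metric LC _ _ _ hdF).
  rewrite (gf_sym gM hcx u) !induced_minus_quarter /G.
  exact: metric_split.
- apply: (open_near (locdom_open c d) hx) => y hy e; apply: metric_linearl.
  exact: locdom_img.
- apply: (open_near (locdom_open c d) hx) => y hy e; apply: metric_linearr.
  exact: locdom_img.
Qed.

Lemma induced_quarter (DM : connection M) u v : levi_civita gM DM ->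
  DqM c x u v = DM c x u v + quarter_term gM xiM c x u v.
Proof.
move=> LCM; apply/eqP; rewrite -subr_eq; apply/eqP.
move: u v; apply: (koszul_unique (g := gM) hcx
  (S := fun u v => DqM c x u v - quarter_term gM xiM c x u v)).
- by move=> a b; exact: induced_minus_quarter_sym.
- by move=> a b; exact: (levi_civita_sym LCM).
- move=> e a b; rewrite -(levi_civita_metric LCM _ _ _ hcx).
  by rewrite induced_minus_quarter_metric.
Qed.

(** Along M the field xi is the push-forward of its restriction, so its
    ambient derivative in the direction dF u, which is
    alpha phi(dF u) + H(dF u, xi) = (alpha - 1) phi(dF u), is already tangent
    to M. *)
Lemma induced_quarter_nabla_xi (alpha : N -> R) u :
  lcs_structure g D xi alpha ->
  nabla DqM c (cst u) (xiM c) x =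
    (alpha (iota (cinv (coord c) x)) - 1) *: phi gM xiM c x u.
Proof.
move=> lcs.
have sc e : local_field c (cst e) by exact: smooth_cst.
have sd e : local_field d (cst e) by exact: smooth_cst.
have dxi : differentiable (xi d) (F x).
  exact: smooth_differentiable (vf_smooth xi d) hdF.
have push_xi : 'D_u (push F (xiM c)) x = 'D_('D_u F x) (xi d) (F x).
  rewrite -(derive_comp u dF dxi).
  apply: near_eq_derive; apply: (open_near (locdom_open c d) hx) => y hy.
  exact: hxiM.
have nabla_xi : nabla Dq d (cst ('D_u F x)) (xi d) (F x) =
    (alpha (iota (cinv (coord c) x)) - 1) *: phi g xi d (F x) ('D_u F x).
  rewrite (hDq (sd _) (vf_smooth xi d) hdF) -addrA quarter_termE//.
  rewrite (lcs_nabla_xi lcs (sd _) hdF) {1}/loc cmapK; last by case: hx.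
  rewrite /quarter_term {1}/eta (lcs_timelike lcs hdF) /phi /eta.
  by apply/rowP => j; rewrite !mxE; ring.
apply: (metric_inj gM hcx) => w.
have := hDqM (sc u) (vf_smooth xiM c) hx w; rewrite /along push_xi.
rewrite [push F (xiM c) x]/push (hxiM hx) -[X in X - _]/(nabla Dq d (cst ('D_u F x)) (xi d) (F x)).
rewrite nabla_xi -phi_restrict -dFZ metricBl// => /subr0_eq E.
exact: (etrans (hgM hx _ _) (etrans (esym E) (esym (hgM hx _ _)))).
Qed.

End Charts.
End Submanifold.

(** * Curvature and Ricci tensor of the induced connection *)

(** These two identities are stated for plain vectors because comparing
    derivatives as atoms of a ring expression is costly. *)
Lemma scale_pair_algebra (R : realType) (m : nat) (k l dk dl : R)
    (Y dY GY Z dZ GZ : 'rV[R]_m) :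
  dk *: Y + k *: dY - (dl *: Z + l *: dZ) + (k *: GY - l *: GZ)
  = dk *: Y - dl *: Z + k *: (dY + GY) - l *: (dZ + GZ).
Proof. by apply/rowP => j; rewrite !mxE; ring. Qed.

Lemma curvature_algebra (R : realType) (m : nat)
    (A B C P1 P2 P3 P4 Q1 Q4 a1 b1 : 'rV[R]_m) :
  A + (P1 + P2 + a1) + (P3 + P4) - (B + (Q1 + P3 + b1) + (P2 + Q4))
    - (C + (P1 - Q1)) = A - B - C + (a1 - b1 + P4 - Q4).
Proof. by apply/rowP => j; rewrite !mxE; ring. Qed.

(** The situation on M, in one chart: Dq is the Levi-Civita connection plus H,
    and a is the chart expression of the restriction of alpha. *)
Section Intrinsic.
Context {R : realType} {m : nat} {M : manifold R m}.
Variables (g : metric M) (xi : vfield M) (D Dq : connection M) (c : atlas M).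
Variable a : 'rV[R]_m -> R.
Hypothesis LC : levi_civita g D.
Hypothesis timelike : forall x, img c x -> g c x (xi c x) (xi c x) = -1.
Hypothesis DqE : forall x u v, img c x ->
  Dq c x u v = D c x u v + quarter_term g xi c x u v.
Hypothesis nabla_xi : forall x u, img c x ->
  nabla D c (cst u) (xi c) x = a x *: phi g xi c x u.
Local Notation fld := ('rV[R]_m -> 'rV[R]_m).
Local Notation H := (quarter_term g xi c).

Lemma chrDr (E : connection M) x u v1 v2 : img c x ->
  E c x u (v1 + v2) = E c x u v1 + E c x u v2.
Proof. by move=> hx; have := chr_linear_r E hx 1 u v1 v2; rewrite !scale1r. Qed.

Lemma chrZr (E : connection M) x b u v : img c x ->
  E c x u (b *: v) = b *: E c x u v.
Proof.
move=> hx; apply: (addIr (E c x u 0)); rewrite -chrDr// addr0.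
by rewrite -[b *: v]addr0 chr_linear_r// addr0.
Qed.

Lemma chrBr (E : connection M) x u v1 v2 : img c x ->
  E c x u (v1 - v2) = E c x u v1 - E c x u v2.
Proof. by move=> hx; rewrite -scaleN1r chrDr// chrZr// scaleN1r. Qed.

Lemma nabla_quarter (X Y : fld) x : img c x ->
  nabla Dq c X Y x = nabla D c X Y x + H x (X x) (Y x).
Proof. by move=> hx; rewrite /nabla /cov DqE// addrA. Qed.

Lemma nablaD (X V W : fld) x : img c x ->
  differentiable V x -> differentiable W x ->
  nabla D c X (fun y => V y + W y) x = nabla D c X V x + nabla D c X W x.
Proof.
move=> hx dV dW.
have DVW := deriveD (diff_derivable dV : derivable V x (X x)) (diff_derivable dW).
by rewrite /nabla /cov chrDr// -addrACA; congr (_ + _).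
Qed.

Lemma eq_nabla (X V W : fld) x : img c x -> (forall y, img c y -> V y = W y) ->
  nabla D c X V x = nabla D c X W x.
Proof.
move=> hx VW; rewrite /nabla /cov (VW x hx).
have -> // : 'D_(X x) V x = 'D_(X x) W x.
by apply: near_eq_derive; exact: (open_near (img_open c) hx).
Qed.

Lemma nabla_differentiable (X Y : fld) x : img c x ->
  local_field c X -> local_field c Y -> differentiable (nabla D c X Y) x.
Proof.
move=> hx sX sY; have dX := smooth_differentiable sX hx.
have dY := smooth_differentiable sY hx.
apply: differentiableD.
  apply: (@differentiable_linear_arg _ _ _ _ (fun y u => 'D_u Y y)) => //.
    apply: (open_near (img_open c) hx) => y hy; apply: derive_linear.
    exact: smooth_differentiable sY hy.
  by move=> u; exact: smooth_differentiable (smooth_derive u sY) hx.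
apply: (@differentiable_bilinear_arg _ _ _ _ _ (D c)) => //.
- apply: (open_near (img_open c) hx) => y hy v b u1 u2.
  exact: chr_linear_l.
- apply: (open_near (img_open c) hx) => y hy v b u1 u2.
  exact: chr_linear_r.
- by move=> u v; exact: smooth_differentiable (chr_smooth D c u v) hx.
Qed.

Lemma quarter_term_differentiable (Y Z : fld) x : img c x ->
  differentiable Y x -> differentiable Z x ->
  differentiable (fun y => H y (Y y) (Z y)) x.
Proof.
move=> hx dY dZ; have dxi := smooth_differentiable (vf_smooth xi c) hx.
apply: differentiableB; apply: differentiable_scale => //.
  exact: (@differentiable_metric _ _ _ g c x Z (xi c)).
exact: (@differentiable_metric _ _ _ g c x Y Z).
Qed.

(** H is built from g and xi.  As g is parallel, the covariant derivative of H
    only involves that of xi, namely nabla_u xi = a phi(u). *)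
Lemma nabla_quarter_term (X Y Z : fld) x : img c x ->
  differentiable Y x -> differentiable Z x ->
  nabla D c X (fun y => H y (Y y) (Z y)) x =
    H x (nabla D c X Y x) (Z x) + H x (Y x) (nabla D c X Z x)
    + a x *: (g c x (Z x) (phi g xi c x (X x)) *: Y x
              - g c x (Y x) (Z x) *: phi g xi c x (X x)).
Proof.
move=> hx dY dZ; have dxi := smooth_differentiable (vf_smooth xi c) hx.
have dZxi : differentiable (fun y => g c y (Z y) (xi c y) : R^o) x.
  exact: (@differentiable_metric _ _ _ g c x Z (xi c)).
have dYZ : differentiable (fun y => g c y (Y y) (Z y) : R^o) x.
  exact: (@differentiable_metric _ _ _ g c x Y Z).
have := derive_metric LC (X x) hx dZ dxi; rewrite nabla_xi// => DZxi.
have := derive_metric LC (X x) hx dY dZ => DYZ.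
have nxi := nabla_xi (X x) hx.
have -> : nabla D c X (fun y => H y (Y y) (Z y)) x =
   'D_(X x) (fun y => g c y (Z y) (xi c y) : R^o) x *: Y x
   - 'D_(X x) (fun y => g c y (Y y) (Z y) : R^o) x *: xi c x
   + g c x (Z x) (xi c x) *: nabla D c X Y x
   - g c x (Y x) (Z x) *: nabla D c (cst (X x)) (xi c) x.
  have dXx (V : fld) : differentiable V x -> derivable V x (X x).
    exact: diff_derivable.
  have DYZ' := derive_scale (X x) dYZ dxi.
  have DZxi' := derive_scale (X x) dZxi dY.
  have DH : 'D_(X x) (fun y => H y (Y y) (Z y)) x =
      'D_(X x) (fun y => g c y (Z y) (xi c y) : R^o) x *: Y x
        + g c x (Z x) (xi c x) *: 'D_(X x) Y x
      - ('D_(X x) (fun y => g c y (Y y) (Z y) : R^o) x *: xi c x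
        + g c x (Y x) (Z x) *: 'D_(X x) (xi c) x).
    rewrite -DZxi' -DYZ'.
    exact: (deriveB (dXx _ (differentiable_scale dZxi dY))
              (dXx _ (differentiable_scale dYZ dxi))).
  rewrite /nabla /cov DH.
  rewrite /quarter_term chrBr// chrZr// chrZr//.
  exact: scale_pair_algebra.
rewrite DZxi DYZ nxi /quarter_term /eta !metricZr//.
rewrite -[nabla D c (cst (X x)) Y x]/(nabla D c X Y x).
rewrite -[nabla D c (cst (X x)) Z x]/(nabla D c X Z x).
by apply/rowP => j; rewrite !mxE; ring.
Qed.

Lemma quarter_termDr x u v1 v2 : img c x ->
  H x u (v1 + v2) = H x u v1 + H x u v2.
Proof.
move=> hx; rewrite /quarter_term /eta metricDl// metricDr//.
by rewrite !scalerDl opprD addrACA.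
Qed.

Lemma quarter_termBl x u1 u2 v : img c x ->
  H x (u1 - u2) v = H x u1 v - H x u2 v.
Proof.
move=> hx; rewrite /quarter_term metricBl// scalerBl scalerBr.
by apply/rowP => j; rewrite !mxE; ring.
Qed.

(** The tensor (nabla_u H)(y,z) - (nabla_y H)(u,z) + H(u,H(y,z)) - H(y,H(u,z)),
    by which the curvature changes when H is added to the connection. *)
Definition quarter_curvature_diff x (u y z : 'rV[R]_m) : 'rV[R]_m :=
  a x *: (g c x z (phi g xi c x u) *: y - g c x y z *: phi g xi c x u)
  - a x *: (g c x z (phi g xi c x y) *: u - g c x u z *: phi g xi c x y)
  + H x u (H x y z) - H x y (H x u z).

(** The terms containing derivatives of X, Y, Z cancel, since the Levi-Civita
    connection has no torsion: H(nabla_X Y - nabla_Y X, Z) = H([X,Y], Z). *)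
Lemma curvature_quarter (X Y Z : fld) x : img c x ->
  local_field c X -> local_field c Y -> local_field c Z ->
  curvature Dq c X Y Z x =
    curvature D c X Y Z x + quarter_curvature_diff x (X x) (Y x) (Z x).
Proof.
move=> hx sX sY sZ.
have second (V W : fld) : local_field c V -> local_field c W ->
    nabla Dq c V (nabla Dq c W Z) x = nabla D c V (nabla D c W Z) x
      + (H x (nabla D c V W x) (Z x) + H x (W x) (nabla D c V Z x)
         + a x *: (g c x (Z x) (phi g xi c x (V x)) *: W x
              - g c x (W x) (Z x) *: phi g xi c x (V x)))
      + (H x (V x) (nabla D c W Z x) + H x (V x) (H x (W x) (Z x))).
  move=> sV sW; rewrite nabla_quarter// nabla_quarter// quarter_termDr//.
  have dZ := smooth_differentiable sZ hx.
  have dW := smooth_differentiable sW hx.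
  have -> : nabla D c V (nabla Dq c W Z) x =
      nabla D c V (fun y => nabla D c W Z y + H y (W y) (Z y)) x.
    exact: (eq_nabla V hx (nabla_quarter W Z)).
  have dWZ := nabla_differentiable hx sW sZ.
  have dHWZ := quarter_term_differentiable hx dW dZ.
  by rewrite (nablaD V hx dWZ dHWZ) (nabla_quarter_term V hx dW dZ).
rewrite /curvature (second X Y sX sY) (second Y X sY sX) (nabla_quarter _ _ hx).
have [<- _] := LC sX sY sZ hx; rewrite (quarter_termBl _ _ _ hx).
exact: curvature_algebra.
Qed.

(** The trace of the rank one endomorphism u |-> L(u) v is L(v). *)
Lemma sum_linear_diag (L : 'rV[R]_m -> R) (v : 'rV[R]_m) :
  linear (L : 'rV[R]_m -> R^o) ->
  \sum_i L (delta_mx 0 i) * v 0 i = L v.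
Proof.
move=> linL; rewrite [RHS](linear_row_sum (W := R^o) v linL).
by apply: eq_bigr => i _; rewrite mulrC.
Qed.

(** The form used for the trace: each coefficient of y and xi is linear in u,
    and the coefficient of u is constant. *)
Lemma quarter_curvature_diffE x u y z : img c x ->
  quarter_curvature_diff x u y z =
    ((2 * a x - 1) * g c x u z
      + (a x - 1) * eta g xi c x z * eta g xi c x u) *: y
    + ((1 - a x) * g c x y z * eta g xi c x u
      + (a x - 1) * eta g xi c x y * g c x u z) *: xi c x
    + ((1 - 2 * a x) * g c x y z
      + (1 - a x) * (eta g xi c x y * eta g xi c x z)) *: u.
Proof.
move=> hx; rewrite /quarter_curvature_diff /quarter_term /phi /eta.
rewrite !(gf_sym g hx z) !metricBl// !metricZl// !metricDl// !metricZl//.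
rewrite !metricBr// !metricZr//.
rewrite (gf_sym g hx y u) (gf_sym g hx (xi c x) z) timelike//.
by apply/rowP => j; rewrite !mxE; ring.
Qed.

Lemma trace_quarter_curvature_diff x y z : img c x ->
  \tr (lin1_mx (fun u => quarter_curvature_diff x u y z)) =
    a x * ((3 - 2 * m%:R) * g c x y z
      + (2 - m%:R) * (eta g xi c x y * eta g xi c x z))
    + (m%:R - 2) * (g c x y z + eta g xi c x y * eta g xi c x z).
Proof.
move=> hx.
have sg := @sum_linear_diag (fun u => g c x u z) _ (metric_linearl g z hx).
have se := @sum_linear_diag (fun u => eta g xi c x u) _
  (metric_linearl g (xi c x) hx).
transitivity (\sum_i
   ((2 * a x - 1) * (g c x (delta_mx 0 i) z * y 0 i)
     + (a x - 1) * eta g xi c x z * (eta g xi c x (delta_mx 0 i) * y 0 i)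
     + (1 - a x) * g c x y z * (eta g xi c x (delta_mx 0 i) * xi c x 0 i)
     + (a x - 1) * eta g xi c x y * (g c x (delta_mx 0 i) z * xi c x 0 i)
     + ((1 - 2 * a x) * g c x y z
      + (1 - a x) * (eta g xi c x y * eta g xi c x z)))).
  apply: eq_bigr => i _; rewrite mxE quarter_curvature_diffE// !mxE !eqxx /=.
  ring.
rewrite !big_split /= -!mulr_sumr !sg !se !sumr_const card_ord.
rewrite -[g c x y z *+ m]mulr_natr -[eta g xi c x z *+ m]mulr_natr.
rewrite (gf_sym g hx (xi c x) z) /eta timelike//.
ring.
Qed.

Lemma ricci_quarter (Y Z : fld) x : img c x ->
  local_field c Y -> local_field c Z ->
  ricci Dq c Y Z x = ricci D c Y Z x
    + (a x * ((3 - 2 * m%:R) * g c x (Y x) (Z x)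
      + (2 - m%:R) * (eta g xi c x (Y x) * eta g xi c x (Z x)))
    + (m%:R - 2) * (g c x (Y x) (Z x) + eta g xi c x (Y x) * eta g xi c x (Z x))).
Proof.
move=> hx sY sZ; rewrite -trace_quarter_curvature_diff// -raddfD.
congr (\tr _); apply/matrixP => i j.
have s u : local_field c (cst u) by exact: smooth_cst.
rewrite [LHS]mxE (curvature_quarter hx (s _) sY sZ) [LHS]mxE [RHS]mxE.
by congr (_ + _); rewrite [RHS]mxE.
Qed.

End Intrinsic.

(** * The soliton equation *)

Lemma smooth_fun_affine (R : realType) (m : nat) (M : manifold R m)
    (f : M -> R) (k l : R) :
  smooth_fun f -> smooth_fun (fun p => k * f p + l).
Proof.
move=> sf c j; have oc := img_open c.
apply: (CkD oc); last exact: (Ck_cst _ _ (l : R^o)).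
by apply: (Ck_scale oc); [exact: (Ck_cst _ _ (k : R^o))|exact: sf].
Qed.

(** The soliton equation, with the values of the Lie derivative and of the
    Ricci tensor inserted, solved for the Levi-Civita Ricci tensor S; here ee
    is eta(Y) eta(Z). *)
Lemma soliton_algebra (R : realFieldType) (m : nat) (a lambda S g ee : R) :
  2 * ((a - 1) * (g + ee))
    + 2 * (S + (a * ((3 - 2 * m%:R) * g + (2 - m%:R) * ee)
                + (m%:R - 2) * (g + ee)))
    + 2 * lambda * g = 0 ->
  S = ((2 * m%:R - 4) * a + (3 - m%:R - lambda)) * g
      + ((m%:R - 3) * a + (3 - m%:R)) * ee.
Proof. by move=> E; lra. Qed.

Theorem theorem4p1 (R : realType) (n m : nat) (hmn : (m < n)%N)
    (Mt : manifold R n) (g : metric Mt) (D : connection Mt) (xi : vfield Mt)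
    (alpha : Mt -> R) (hlcs : lcs_structure g D xi alpha)
    (Dq : connection Mt) (hDq : quarter_symmetric g D xi Dq)
    (M : manifold R m) (iota : M -> Mt) (hsub : submanifold iota)
    (hinv : invariant_submanifold iota g xi)
    (gM : metric M) (hgM : induced_metric iota g gM)
    (xiM : vfield M) (hxiM : restricts_to iota xi xiM)
    (DqM : connection M) (hDqM : induced_connection iota g Dq DqM)
    (lambda : R) (hsol : ricci_soliton gM xiM DqM lambda)
    (DM : connection M) (hDM : levi_civita gM DM) :
  eta_einstein gM xiM DM.
Proof.
have LC := lcs_levi_civita hlcs.
pose a p : R := alpha (iota p).
have sa : smooth_fun a.
  by apply: smooth_fun_comp => //; exact: (lcs_alpha_smooth hlcs).
exists (fun p => (2 * m%:R - 4) * a p + (3 - m%:R - lambda)).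
exists (fun p => (m%:R - 3) * a p + (3 - m%:R)).
split; [exact: smooth_fun_affine|exact: smooth_fun_affine|].
move=> c Y Z sY sZ x hx.
have DqE y u v : img c y ->
    DqM c y u v = DM c y u v + quarter_term gM xiM c y u v.
  move=> /(locdom_cover iota)[d hd].
  exact: (induced_quarter hsub hgM hxiM hd LC hDq hDqM u v hDM).
have timelike y : img c y -> gM c y (xiM c y) (xiM c y) = -1.
  move=> /(locdom_cover iota)[d hd]; rewrite (hgM _ _ _ hd) (hxiM _ _ _ hd).
  exact: (lcs_timelike hlcs (locdom_img hd)).
have nabla_qxi y u : img c y -> nabla DqM c (cst u) (xiM c) y =
    (a (cinv (coord c) y) - 1) *: phi gM xiM c y u.
  move=> /(locdom_cover iota)[d hd].
  exact: (induced_quarter_nabla_xi hsub hgM hxiM hd hDq hDqM u hlcs).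
have nabla_xi y u : img c y ->
    nabla DM c (cst u) (xiM c) y = a (cinv (coord c) y) *: phi gM xiM c y u.
  (* H(u, xi) = - phi u, so removing H adds phi u *)
  move=> hy; have := nabla_qxi y u hy.
  rewrite (nabla_quarter DqE) // /quarter_term /phi /eta timelike// => E.
  apply: (addIr ((-1) *: u - gM c y u (xiM c y) *: xiM c y)); rewrite E.
  by apply/rowP => j; rewrite !mxE; ring.
(* the derivatives of xi at x depend on Y and Z only through Y x and Z x *)
have := hsol c Y Z sY sZ x hx.
rewrite -[nabla DqM c Y (xiM c) x]/(nabla DqM c (cst (Y x)) (xiM c) x).
rewrite -[nabla DqM c Z (xiM c) x]/(nabla DqM c (cst (Z x)) (xiM c) x).
rewrite !nabla_qxi// (ricci_quarter hDM timelike DqE nabla_xi hx sY sZ).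
move=> E; apply: soliton_algebra; rewrite -[RHS]E; congr (_ + _ + _).
rewrite metricZl// metricZr// /phi metricDl// metricDr// metricZl// metricZr//.
rewrite (gf_sym gM hx (xiM c x) (Z x)) -![gM c x _ (xiM c x)]/(eta gM xiM c x _).
ring.
Qed.
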